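(* Let $w_1,w_2,w_3$ be any positive integers. Then for every integer $n\ge 0$ and every $y_1\in\mathbb{Z}_p$, the following six expressions are equal: \begin{align*} &w_1^{n-1}\sum_{k=0}^{n}\binom{n}{k}\sum_{a=0}^{dw_1-1}\chi(a)\xi^{aw_2w_3}B_{k,\chi,\xi^{w_1w_3}}\Big(w_2y_1+\frac{w_2}{w_1}a\Big)S_{n-k}(dw_3-1;\chi,\xi^{w_1w_2})\,w_2^{n-k}w_3^{k-1}\\ =&w_1^{n-1}\sum_{k=0}^{n}\binom{n}{k}\sum_{a=0}^{dw_1-1}\chi(a)\xi^{aw_2w_3}B_{k,\chi,\xi^{w_1w_2}}\Big(w_3y_1+\frac{w_3}{w_1}a\Big)S_{n-k}(dw_2-1;\chi,\xi^{w_1w_3})\,w_3^{n-k}w_2^{k-1}\\ =&w_2^{n-1}\sum_{k=0}^{n}\binom{n}{k}\sum_{a=0}^{dw_2-1}\chi(a)\xi^{aw_1w_3}B_{k,\chi,\xi^{w_2w_3}}\Big(w_1y_1+\frac{w_1}{w_2}a\Big)S_{n-k}(dw_3-1;\chi,\xi^{w_1w_2})\,w_1^{n-k}w_3^{k-1}\\ =&w_2^{n-1}\sum_{k=0}^{n}\binom{n}{k}\sum_{a=0}^{dw_2-1}\chi(a)\xi^{aw_1w_3}B_{k,\chi,\xi^{w_1w_2}}\Big(w_3y_1+\frac{w_3}{w_2}a\Big)S_{n-k}(dw_1-1;\chi,\xi^{w_2w_3})\,w_3^{n-k}w_1^{k-1}\\ =&w_3^{n-1}\sum_{k=0}^{n}\binom{n}{k}\sum_{a=0}^{dw_3-1}\chi(a)\xi^{aw_1w_2}B_{k,\chi,\xi^{w_2w_3}}\Big(w_1y_1+\frac{w_1}{w_3}a\Big)S_{n-k}(dw_2-1;\chi,\xi^{w_1w_3})\,w_1^{n-k}w_2^{k-1}\\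 =&w_3^{n-1}\sum_{k=0}^{n}\binom{n}{k}\sum_{a=0}^{dw_3-1}\chi(a)\xi^{aw_1w_2}B_{k,\chi,\xi^{w_1w_3}}\Big(w_2y_1+\frac{w_2}{w_3}a\Big)S_{n-k}(dw_1-1;\chi,\xi^{w_2w_3})\,w_2^{n-k}w_1^{k-1}. \end{align*}
   Context: Let $p$ be a fixed prime, $\mathbb{Z}_p$ the ring of $p$-adic integers, and $\mathbb{C}_p$ the completion of an algebraic closure of $\mathbb{Q}_p$. Let $\Gamma_r=\{\xi\in\mathbb{C}_p : \xi^{p^s}=1 \text{ for some } s\in\mathbb{Z}_{>0}\}$ (ramified roots of unity) and fix any $\xi\in\Gamma_r$. Let $d$ be a fixed positive integer and $\chi$ a (primitive) Dirichlet character of conductor $d$, viewed as a function $\mathbb{Z}\to\mathbb{C}_p$ via a fixed embedding $\overline{\mathbb{Q}}\to\mathbb{C}_p$ (periodic mod $d$, zero on integers not coprime to $d$; if $d=1$, $\chi\equiv 1$). For $\eta\in\Gamma_r$, the generalized twisted Bernoulli polynomials $B_{n,\chi,\eta}(x)$ attached to $\chi$ and $\eta$ are the polynomials in $x$ with coefficients in $\mathbb{C}_p$ (hence evaluable at any element of $\mathbb{C}_p$) defined by the power series expansion in $t$ $$\frac{te^{xt}}{\eta^{d}e^{dt}-1}\sum_{a=0}^{d-1}\chi(a)\eta^{a}e^{at}=\sum_{n=0}^{\infty}B_{n,\chi,\eta}(x)\frac{t^n}{n!}.$$ For integers $k,n\ge 0$ and $\eta\in\Gamma_r$, the $k$th generalized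 twisted power sum is $S_k(n;\chi,\eta)=\sum_{a=0}^{n}\chi(a)\eta^a a^k$, with the convention $0^0=1$. *)

(* Defs.v *)
From HB Require Import structures.
From mathcomp Require Import all_boot all_order all_algebra all_field.
From mathcomp Require Import boolp classical_sets reals.

Set Implicit Arguments.
Unset Strict Implicit.
Unset Printing Implicit Defensive.
Import Order.TTheory GRing.Theory Num.Theory.
Local Open Scope ring_scope.

(** * The field C_p *)

Definition padic_val (p : nat) (x : rat) : int :=
  (logn p `|numq x|)%:Z - (logn p `|denq x|)%:Z.

Definition padic_abs (R : realType) (p : nat) (x : rat) : R :=
  if x == 0 then 0 else p%:R ^ (- padic_val p x).

Definition ultrametric_abs (R : realType) (K : fieldType) (v : K -> R) : Prop :=
  [/\ forall x, 0 <= v x,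
      forall x, v x = 0 <-> x = 0,
      forall x y, v (x * y) = v x * v y
    & forall x y, v (x + y) <= Num.max (v x) (v y)].

Definition abs_cauchy (R : realType) (K : fieldType) (v : K -> R)
    (u : nat -> K) : Prop :=
  forall e : R, 0 < e -> exists N : nat, forall m n : nat,
    (N <= m)%N -> (N <= n)%N -> v (u m - u n) < e.

Definition abs_converges (R : realType) (K : fieldType) (v : K -> R)
    (u : nat -> K) (l : K) : Prop :=
  forall e : R, 0 < e -> exists N : nat, forall n : nat,
    (N <= n)%N -> v (u n - l) < e.

Definition is_completion (R : realType) (K L : fieldType)
    (v : K -> R) (w : L -> R) (i : {rmorphism K -> L}) : Prop :=
  [/\ ultrametric_abs w,
      forall x, w (i x) = v x,
      forall (y : L) (e : R), 0 < e -> exists x : K, w (y - i x) < e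
    & forall u : nat -> L, abs_cauchy w u -> exists l, abs_converges w u l].

Definition is_algebraic_closure (K L : fieldType) (i : {rmorphism K -> L}) :
    Prop :=
  GRing.closed_field_axiom L /\ forall x : L, algebraicOver i x.

(* The tower Q -> Q_p -> Qbar_p -> C_p with its absolute values, normalised by
   |p| = 1/p.  As a completion and an algebraic closure are only defined up to
   isomorphism, so is the tower: an inhabitant is one choice of these fields. *)
Record padic_tower (R : realType) (p : nat) := PadicTower {
  Qp : fieldType;
  Qp_abs : Qp -> R;
  rat_to_Qp : {rmorphism rat -> Qp};
  Qp_completion : is_completion (@padic_abs R p) Qp_abs rat_to_Qp;
  Qpbar : fieldType;
  Qpbar_abs : Qpbar -> R;
  Qp_to_Qpbar : {rmorphism Qp -> Qpbar};
  Qpbar_closure : is_algebraic_closure Qp_to_Qpbar;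
  Qpbar_abs_ultrametric : ultrametric_abs Qpbar_abs;
  Qpbar_abs_extends : forall x, Qpbar_abs (Qp_to_Qpbar x) = Qp_abs x;
  Cp : fieldType;
  Cp_abs : Cp -> R;
  Qpbar_to_Cp : {rmorphism Qpbar -> Cp};
  Cp_completion : is_completion Qpbar_abs Cp_abs Qpbar_to_Cp
}.

Definition Qp_to_Cp (R : realType) (p : nat) (T : padic_tower R p)
    (x : Qp T) : Cp T :=
  Qpbar_to_Cp T (Qp_to_Qpbar T x).

Definition padic_integer (R : realType) (p : nat) (T : padic_tower R p)
    (x : Qp T) : Prop :=
  Qp_abs x <= 1.

Definition ramified_root (K : fieldType) (p : nat) (xi : K) : Prop :=
  exists2 s : nat, (0 < s)%N & xi ^+ (p ^ s) = 1.

(** * Dirichlet characters *)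

Definition dirichlet_char (A : fieldType) (d : nat) (chi : int -> A) : Prop :=
  [/\ chi 1 = 1,
      forall a b, chi (a * b) = chi a * chi b,
      forall a, chi (a + d%:Z) = chi a
    & forall a, (chi a == 0) = ~~ coprimez a d].

(* For e dividing d: chi factors through the units modulo e. *)
Definition induced_modulus (A : fieldType) (d : nat) (chi : int -> A)
    (e : nat) : Prop :=
  (e %| d)%N /\
  forall a : int, coprimez a d -> (a = 1 %[mod e])%Z -> chi a = 1.

Definition primitive_dirichlet_char (A : fieldType) (d : nat)
    (chi : int -> A) : Prop :=
  dirichlet_char d chi /\
  forall e : nat, induced_modulus d chi e -> e = d.

(** * Generalized twisted Bernoulli polynomials and power sums *)

(* A formal power series in t is its sequence of coefficients; the ring
   operations that the function type may carry pointwise are not the ones of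
   power series, hence the explicit Cauchy product. *)
Definition fps (A : Type) := nat -> A.

Definition fps_mul (A : pzRingType) (f g : fps A) : fps A :=
  fun n => \sum_(i < n.+1) f i * g (n - i)%N.

Definition fps_const (A : pzRingType) (c : A) : fps A :=
  fun n => if n == 0%N then c else 0.

Definition fps_t (A : pzRingType) : fps A := fun n => (n == 1%N)%:R.

(* e^{ct} *)
Definition fps_exp (K : fieldType) (c : {poly K}) : fps {poly K} :=
  fun n => (n`!%:R)^-1 *: c ^+ n.

(* eta^d e^{dt} - 1 *)
Definition bernoulli_den (K : fieldType) (d : nat) (eta : K) :
    fps {poly K} :=
  fun n => (eta ^+ d) *: fps_exp d%:R n - fps_const 1 n.

(* t e^{xt} \sum_{a < d} chi(a) eta^a e^{at}, where x is the variable of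
   {poly K} *)
Definition bernoulli_num (K : fieldType) (d : nat) (chi : int -> K) (eta : K) :
    fps {poly K} :=
  fps_mul (fps_mul (@fps_t {poly K}) (fps_exp 'X))
    (fun n => \sum_(a < d) (chi (a : nat)%:Z * eta ^+ a) *: fps_exp a%:R n).

(* \sum_n B_n(x) t^n/n! *)
Definition fps_egf (K : fieldType) (B : nat -> {poly K}) : fps {poly K} :=
  fun n => (n`!%:R)^-1 *: B n.

(* The denominator is cleared because it is not a unit of K[x][[t]] when
   eta^d = 1; it is never a zero divisor (twisted_bernoulli_unique). *)
Definition is_twisted_bernoulli (K : fieldType) (d : nat) (chi : int -> K)
    (eta : K) (B : nat -> {poly K}) : Prop :=
  forall n, fps_mul (bernoulli_den d eta) (fps_egf B) n
            = bernoulli_num d chi eta n.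

Definition twisted_bernoulli (K : fieldType) (d : nat) (chi : int -> K)
    (eta : K) : nat -> {poly K} :=
  xget (fun=> 0) (is_twisted_bernoulli d chi eta : set (nat -> {poly K})).

(* S_k(n; chi, eta); here 0 ^+ 0 = 1. *)
Definition twisted_power_sum (K : fieldType) (chi : int -> K) (eta : K)
    (k n : nat) : K :=
  \sum_(a < n.+1) chi (a : nat)%:Z * eta ^+ a * a%:R ^+ k.

(** * Existence and uniqueness of the Bernoulli polynomials *)

Lemma Cp_pchar0 (R : realType) (p : nat) (T : padic_tower R p) :
  [pchar (Cp T)] =i pred0.
Proof.
move=> q; rewrite (fmorph_pchar (Qpbar_to_Cp T)) (fmorph_pchar (Qp_to_Qpbar T)).
by rewrite (fmorph_pchar (rat_to_Qp T)) pchar_num.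
Qed.

Lemma fps_div_exists (K : fieldType) (c : nat -> K) (h : fps {poly K}) :
  c 0%N != 0 ->
  exists q : fps {poly K}, forall n, fps_mul (fun i => (c i)%:P) q n = h n.
Proof.
move=> c0.
pose step (s : seq {poly K}) := rcons s ((c 0%N)^-1 *:
  (h (size s) - \sum_(i < size s) (c i.+1)%:P * s`_(size s - i.+1))).
pose S n := iter n step [::].
have sS n : size (S n) = n by elim: n => //= n IH; rewrite size_rcons IH.
pose q n := (S n.+1)`_n.
have SE m n : (m < n)%N -> (S n)`_m = q m.
  elim: n => // n IH; rewrite ltnS leq_eqVlt => /predU1P[-> //|lmn].
  by rewrite [S _]/= /step nth_rcons sS lmn IH.
exists q => n; rewrite /fps_mul big_ord_recl subn0.
have -> : q n = (c 0%N)^-1 *: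
    (h n - \sum_(i < n) (c i.+1)%:P * q (n - i.+1)%N).
  rewrite {1}/q [S _]/= /step nth_rcons sS ltnn eqxx; congr (_ *: (_ - _)).
  by apply: eq_bigr => i _; rewrite SE// ltn_subrL (leq_ltn_trans _ (ltn_ord i)).
by rewrite mul_polyC scalerA divff// scale1r subrK.
Qed.

Lemma fps_mul_lreg (K : fieldType) (f g g' : fps {poly K}) (m : nat) :
  f m != 0 -> (forall n, fps_mul f g n = fps_mul f g' n) ->
  forall n, g n = g' n.
Proof.
move=> fm0 fg; have ex : exists m, f m != 0 by exists m.
case: (ex_minnP ex) => {fm0}{ex}m fm0 minm; elim/ltn_ind => n IH.
have := fg (m + n)%N; rewrite /fps_mul.
have mn : (m < (m + n).+1)%N by rewrite ltnS leq_addr.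
rewrite (bigD1 (Ordinal mn))//= [in RHS](bigD1 (Ordinal mn))//= addKn.
set s := \sum_(i < _ | _) _; set s' := \sum_(i < _ | _) _.
have -> : s = s'.
  apply: eq_bigr => i ni; case: (ltnP i m) => im.
    have [-> |/minm] := eqVneq (f i) 0; first by rewrite !mul0r.
    by move=> mi; rewrite ltnNge mi in im.
  have mi : (m < i)%N by rewrite ltn_neqAle im andbT eq_sym; exact: ni.
  have le_i : (i <= m + n)%N by rewrite -ltnS ltn_ord.
  by rewrite IH// ltn_subLR// ltn_add2r.
by move/addIr/(mulfI fm0).
Qed.

Lemma bernoulli_denE (K : fieldType) (d : nat) (eta : K) n :
  bernoulli_den d eta n =
  (eta ^+ d * (n`!%:R^-1 * d%:R ^+ n) - (n == 0%N)%:R)%:P.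
Proof.
have dE : (d%:R : {poly K}) ^+ n = (d%:R ^+ n)%:P by rewrite polyC_exp polyC_natr.
rewrite /bernoulli_den /fps_exp /fps_const dE polyCB !polyCM !mul_polyC.
by congr (_ - _); case: (n == 0%N); rewrite ?polyC1 ?polyC0.
Qed.

Lemma bernoulli_den_neq0 (K : fieldType) (d : nat) (eta : K) :
  [pchar K] =i pred0 -> (0 < d)%N ->
  (bernoulli_den d eta 0 != 0) || (eta ^+ d == 1) && (bernoulli_den d eta 1 != 0).
Proof.
move=> /pcharf0P K0 d0; rewrite !bernoulli_denE !polyC_eq0 /=.
rewrite expr0 expr1 fact0 invr1 !mulr1 subr_eq0.
have [->|//] := eqVneq (eta ^+ d) 1.
by rewrite !mul1r subr0 K0 -lt0n.
Qed.

Lemma twisted_bernoulli_unique (K : fieldType) (d : nat) (chi : int -> K)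
    (eta : K) (B B' : nat -> {poly K}) :
  [pchar K] =i pred0 -> (0 < d)%N ->
  is_twisted_bernoulli d chi eta B -> is_twisted_bernoulli d chi eta B' ->
  B = B'.
Proof.
move=> K0 d0 HB HB'; apply/funext => n.
have fB n' : fps_mul (bernoulli_den d eta) (fps_egf B) n' =
             fps_mul (bernoulli_den d eta) (fps_egf B') n' by rewrite HB HB'.
have E : fps_egf B n = fps_egf B' n.
  by case/orP: (bernoulli_den_neq0 eta K0 d0) => [h|/andP[_ h]];
    exact: (fps_mul_lreg h fB).
move: E; rewrite /fps_egf; apply: scalerI.
by rewrite invr_eq0 (pcharf0P K).1// -lt0n fact_gt0.
Qed.

Lemma twisted_bernoulliP (K : fieldType) (d : nat) (chi : int -> K) (eta : K) :
  [pchar K] =i pred0 -> (0 < d)%N ->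
  is_twisted_bernoulli d chi eta (twisted_bernoulli d chi eta).
Proof.
move=> K0 d0; rewrite /twisted_bernoulli; case: xgetP => [_ _ //|noB].
suff [q hq] : exists q : fps {poly K}, forall n,
    fps_mul (bernoulli_den d eta) q n = bernoulli_num d chi eta n.
  case: (noB (fun n => n`!%:R *: q n)) => n; rewrite -hq; apply: eq_bigr => i _.
  rewrite /fps_egf scalerA mulVf ?scale1r//.
  by rewrite (pcharf0P K).1// -lt0n fact_gt0.
pose c n := eta ^+ d * (n`!%:R^-1 * d%:R ^+ n) - (n == 0%N)%:R.
have cE : bernoulli_den d eta = fun n => (c n)%:P.
  by apply/funext => n; rewrite bernoulli_denE.
have := bernoulli_den_neq0 eta K0 d0; rewrite cE !polyC_eq0.
case/orP=> [c0|/andP[/eqP etad c1]]; first exact: fps_div_exists.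
have [q hq] := @fps_div_exists K (c \o S) (bernoulli_num d chi eta \o S) c1.
exists q => -[|n].
  rewrite /bernoulli_num /fps_mul !big_ord_recl !big_ord0 /fps_t/=.
  by rewrite !mul0r !addr0 mul0r /c etad fact0 invr1 expr0 !mulr1 subrr mul0r.
rewrite -[RHS]hq /fps_mul big_ord_recl /=.
rewrite {1}/c etad fact0 invr1 expr0 !mulr1 subrr mul0r add0r.
by apply: eq_bigr => i _; rewrite subSS.
Qed.

(* Main.v *)
(* Let X = xi * e^t, as a formal power series, and P(z) = sum_(a < d) chi(a) z^a.
   Since chi has period d, sum_(a < d m) chi(a) z^a = P(z) (z^(d m) - 1) / (z^d - 1),
   and therefore the exponential generating function in n of each of the six
   expressions is
     t e^(w1 w2 w3 y t) P(X^(w2 w3)) P(X^(w1 w3)) P(X^(w1 w2)) (X^(d w1 w2 w3) - 1)^2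
       / ((X^(d w2 w3) - 1) (X^(d w1 w3) - 1) (X^(d w1 w2) - 1)),
   which is symmetric in w1, w2, w3.  The identity is used with denominators
   cleared: in characteristic 0, X^m - 1 is not a zero divisor for m > 0, its
   coefficients of t^0 and t^1 being xi^m - 1 and m xi^m. *)

Require Import Defs.
From HB Require Import structures.
From mathcomp Require Import all_boot all_order all_algebra all_field.
From mathcomp Require Import boolp reals ring.

Set Implicit Arguments.
Unset Strict Implicit.
Unset Printing Implicit Defensive.
Import GRing.Theory.
Local Open Scope ring_scope.

(* An alias of the function type, so that the ring structure is the Cauchy
   product and not the pointwise one. *)
Definition pseries (A : comNzRingType) : Type := fps A.

(** * The ring of formal power series and the substitution of s t for t *)

Section PowerSeriesRing.
Variable A : comNzRingType.
Implicit Types f g h : pseries A.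

HB.instance Definition _ := gen_eqMixin (pseries A).
HB.instance Definition _ := gen_choiceMixin (pseries A).

Definition ps_add f g : pseries A := fun n => f n + g n.
Definition ps_opp f : pseries A := fun n => - f n.
Definition ps_mul f g : pseries A := fps_mul f g.
Definition ps_const (c : A) : pseries A := fps_const c.

Lemma ps_addA : associative ps_add.
Proof. by move=> f g h; apply/funext => n; exact: addrA. Qed.

Lemma ps_addC : commutative ps_add.
Proof. by move=> f g; apply/funext => n; exact: addrC. Qed.

Lemma ps_add0 : left_id (ps_const 0) ps_add.
Proof.
by move=> f; apply/funext => n; rewrite /ps_add/ps_const/fps_const if_same add0r.
Qed.

Lemma ps_addN : left_inverse (ps_const 0) ps_opp ps_add.
Proof.
move=> f; apply/funext => n.
by rewrite /ps_add/ps_opp/ps_const/fps_const if_same addNr.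
Qed.

HB.instance Definition _ := GRing.isZmodule.Build (pseries A)
  ps_addA ps_addC ps_add0 ps_addN.

(* Truncation transports the ring axioms from polynomials to power series. *)
Definition ps_trunc n f : {poly A} := \poly_(i < n) f i.

Lemma ps_mul_trunc n f g i : (i < n)%N ->
  ps_mul f g i = (ps_trunc n f * ps_trunc n g)`_i.
Proof.
move=> ltin; rewrite coefM; apply: eq_bigr => j _.
have ltjn : (j < n)%N by apply: leq_trans (ltn_ord j) _.
by rewrite !coef_poly ltjn (leq_ltn_trans (leq_subr _ _) ltin).
Qed.

Lemma ps_mulC : commutative ps_mul.
Proof.
move=> f g; apply/funext => n.
by rewrite !(@ps_mul_trunc n.+1) // mulrC.
Qed.

(** Coefficients up to n of a product involve only coefficients up to n of the factors, so
    truncation at [n.+1] serves for the inner and the outer products alike. *)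
Lemma ps_mulA : associative ps_mul.
Proof.
move=> f g h; apply/funext => n.
have truncE k f1 g1 : (k <= n)%N ->
    ps_mul f1 g1 k = (ps_trunc n.+1 f1 * ps_trunc n.+1 g1)`_k.
  by move=> lekn; apply: ps_mul_trunc.
transitivity (ps_trunc n.+1 f * ps_trunc n.+1 g * ps_trunc n.+1 h)`_n.
  rewrite -mulrA coefM; apply: eq_bigr => i _.
  by rewrite coef_poly ltn_ord truncE ?leq_subr.
rewrite coefM; apply: eq_bigr => i _; rewrite truncE -1?ltnS //.
by rewrite coef_poly ltnS leq_subr.
Qed.

Lemma ps_constM c f n : ps_mul (ps_const c) f n = c * f n.
Proof.
rewrite /ps_mul/fps_mul big_ord_recl subn0 big1 ?addr0// => i _.
by rewrite /ps_const/fps_const mul0r.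
Qed.

Lemma ps_mul1 : left_id (ps_const 1) ps_mul.
Proof. by move=> f; apply/funext => n; rewrite ps_constM mul1r. Qed.

Lemma ps_mulDl : left_distributive ps_mul ps_add.
Proof.
move=> f g h; apply/funext => n.
by rewrite /ps_add -big_split; apply: eq_bigr => i _; rewrite mulrDl.
Qed.

Lemma ps_1neq0 : ps_const 1 != 0.
Proof.
by apply/eqP => /(congr1 (fun f : pseries A => f 0%N)) /eqP; rewrite oner_eq0.
Qed.

HB.instance Definition _ := GRing.Zmodule_isComNzRing.Build (pseries A)
  ps_mulA ps_mulC ps_mul1 ps_mulDl ps_1neq0.

Lemma psBE f g n : (f - g) n = f n - g n. Proof. by []. Qed.
Lemma psME f g n : (f * g) n = \sum_(i < n.+1) f i * g (n - i)%N.
Proof. by []. Qed.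
Lemma psCME c f n : (ps_const c * f) n = c * f n.
Proof. exact: ps_constM. Qed.
Lemma ps1E n : (1 : pseries A) n = (n == 0%N)%:R.
Proof. by case: n. Qed.

Lemma ps_sumE I (r : seq I) (P : pred I) (F : I -> pseries A) n :
  (\sum_(i <- r | P i) F i) n = \sum_(i <- r | P i) F i n.
Proof.
elim/big_rec2: _ => [|i x f _ <- //].
by case: n.
Qed.

Lemma ps_const_is_zmod_morphism : zmod_morphism ps_const.
Proof.
move=> a b; apply/funext => -[|n]; first by [].
by rewrite psBE /ps_const/fps_const/= subrr.
Qed.

Lemma ps_const_is_monoid_morphism : monoid_morphism ps_const.
Proof.
split=> // a b; apply/funext => n; rewrite psCME.
by case: n => [|n] //; rewrite /ps_const/fps_const/= mulr0.
Qed.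

HB.instance Definition _ := GRing.isZmodMorphism.Build A (pseries A) ps_const
  ps_const_is_zmod_morphism.
HB.instance Definition _ := GRing.isMonoidMorphism.Build A (pseries A) ps_const
  ps_const_is_monoid_morphism.

(** The substitution of s t for t; it absorbs the weights that are powers of the w's. *)
Definition ps_scale (s : A) f : pseries A := fun n => s ^+ n * f n.

Lemma ps_scale_is_zmod_morphism s : zmod_morphism (ps_scale s).
Proof. by move=> f g; apply/funext => n; rewrite psBE /ps_scale -mulrBr. Qed.

Lemma ps_scale_is_monoid_morphism s : monoid_morphism (ps_scale s).
Proof.
split=> [|f g]; apply/funext => n; rewrite {1}/ps_scale.
  by rewrite ps1E; case: n => [|n]; rewrite ?mulr1 ?mulr0.
rewrite !psME mulr_sumr; apply: eq_bigr => i _.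
have lein : (i <= n)%N by rewrite -ltnS.
by rewrite /ps_scale -{1}(subnKC lein) exprD mulrACA.
Qed.

HB.instance Definition _ s := GRing.isZmodMorphism.Build (pseries A) (pseries A)
  (ps_scale s) (ps_scale_is_zmod_morphism s).
HB.instance Definition _ s := GRing.isMonoidMorphism.Build (pseries A) (pseries A)
  (ps_scale s) (ps_scale_is_monoid_morphism s).

Lemma ps_scaleC s c : ps_scale s (ps_const c) = ps_const c.
Proof.
apply/funext => -[|n]; first by rewrite /ps_scale mul1r.
by rewrite /ps_scale mulr0.
Qed.

Definition ps_t : pseries A := fps_t A.

Lemma ps_scale_t s : ps_scale s ps_t = ps_const s * ps_t.
Proof.
apply/funext => n; rewrite psCME /ps_scale /ps_t /fps_t.
by case: n => [|[|n]]; rewrite ?mulr0.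
Qed.

End PowerSeriesRing.

(** Each block of d terms is a shift of the first one by a power of z^d, so the sum over m blocks
    telescopes after multiplication by z^d - 1. *)
Lemma geometric_periodic (A : comNzRingType) (c : nat -> A) (z : A) d m :
  (forall i, c (i + d)%N = c i) ->
  (z ^+ d - 1) * \sum_(i < d * m) c i * z ^+ i =
  (z ^+ (d * m) - 1) * \sum_(i < d) c i * z ^+ i.
Proof.
move=> cd; elim: m => [|m IHm].
  by rewrite muln0 big_ord0 expr0 subrr mulr0 mul0r.
have cdm i : c (d * m + i)%N = c i.
  elim: m {IHm} => [|m IHm]; first by rewrite muln0.
  by rewrite mulnS -addnA addnC cd.
rewrite mulnSr big_split_ord mulrDr IHm.
under [X in _ + _ * X]eq_bigr do rewrite /= cdm exprD mulrCA.
by rewrite -mulr_sumr exprD; ring.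
Qed.

(** * Cancellation and exponential series in characteristic 0 *)

Section Exponential.
Variables (K : fieldType) (K0 : [pchar K] =i pred0).

Let natr_neq0 n : (0 < n)%N -> n%:R != 0 :> K.
Proof. by rewrite (pcharf0P K).1// lt0n. Qed.

Let factr_neq0 n : n`!%:R != 0 :> K.
Proof. by rewrite natr_neq0// fact_gt0. Qed.

(** This is [fps_mul_lreg], with K embedded in [{poly K}] as the constants. *)
Lemma ps_mulfI (f : pseries K) m : f m != 0 -> injective ( *%R f).
Proof.
move=> fm0 g h fgh; apply/funext => n; apply: (@polyC_inj K).
have fmC0 : (f m)%:P != 0 by rewrite polyC_eq0.
apply: (@fps_mul_lreg K (fun i => (f i)%:P) (fun i => (g i)%:P)
  (fun i => (h i)%:P) m fmC0) => {}n.
have := congr1 (fun F : pseries K => (F n)%:P) fgh; rewrite !psME !rmorph_sum /=.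
under eq_bigr do rewrite polyCM.
by under [in RHS]eq_bigr do rewrite polyCM.
Qed.

Definition ps_exp (c : K) : pseries K := fun n => n`!%:R^-1 * c ^+ n.

Lemma ps_expD a b : ps_exp (a + b) = ps_exp a * ps_exp b.
Proof.
apply/funext => n; rewrite psME /ps_exp addrC exprDn mulr_sumr.
apply: eq_bigr => i _; have lein : (i <= n)%N by rewrite -ltnS.
rewrite -[_ *+ 'C(n, i)]mulr_natr -(bin_fact lein) !natrM.
have bin_neq0 : 'C(n, i)%:R != 0 :> K by rewrite natr_neq0 ?bin_gt0.
by field; rewrite !factr_neq0.
Qed.

Lemma ps_exp0 : ps_exp 0 = 1.
Proof.
apply/funext => n; rewrite ps1E /ps_exp.
by case: n => [|n]; rewrite ?expr0 ?fact0 ?invr1 ?mulr1 // expr0n mulr0.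
Qed.

Lemma ps_expMn c n : ps_exp (c * n%:R) = ps_exp c ^+ n.
Proof.
elim: n => [|n IHn]; first by rewrite mulr0 ps_exp0.
by rewrite -addn1 natrD mulrDr mulr1 ps_expD IHn exprD expr1.
Qed.

Lemma ps_scale_exp s c : ps_scale s (ps_exp c) = ps_exp (s * c).
Proof. by apply/funext => n; rewrite /ps_scale/ps_exp exprMn mulrCA. Qed.

(** For [eta = xi] this is the series X. *)
Definition texp (eta : K) : pseries K := ps_const eta * ps_exp 1.

Lemma texpXE eta n : texp eta ^+ n = ps_const (eta ^+ n) * ps_exp n%:R.
Proof. by rewrite exprMn -ps_expMn mul1r rmorphXn. Qed.

Lemma ps_scale_texp s eta : ps_scale s%:R (texp (eta ^+ s)) = texp eta ^+ s.
Proof. by rewrite rmorphM /= ps_scaleC ps_scale_exp mulr1 texpXE. Qed.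

Lemma texpX_sub1_mulfI eta m : (0 < m)%N ->
  injective ( *%R (texp eta ^+ m - 1)).
Proof.
(* If [eta ^+ m = 1], the constant term vanishes and the coefficient of t is m; otherwise the
   constant term is nonzero. *)
move=> m0; have [e1|ne1] := eqVneq (eta ^+ m) 1.
  apply: (@ps_mulfI _ 1); rewrite psBE texpXE psCME e1 ps1E.
  by rewrite /ps_exp (factS 0) invr1 !mul1r subr0 expr1 natr_neq0.
apply: (@ps_mulfI _ 0); rewrite psBE texpXE psCME ps1E.
by rewrite /ps_exp fact0 invr1 !mulr1 subr_eq0.
Qed.

(** * Generating functions of the Bernoulli polynomials and of the power sums *)

Section Bernoulli.
Variables (d : nat) (d_gt0 : (0 < d)%N) (chi : int -> K).

Definition char_sum (m : nat) (z : pseries K) : pseries K :=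
  \sum_(a < m) ps_const (chi (a : nat)%:Z) * z ^+ a.

Definition bernoulli_egf (eta x : K) : pseries K :=
  fun k => k`!%:R^-1 * (twisted_bernoulli d chi eta k).[x].

(** The defining identity over K[x] is evaluated at x coefficient by coefficient. *)
Lemma bernoulli_egfE eta x :
  (texp eta ^+ d - 1) * bernoulli_egf eta x =
  ps_t K * ps_exp x * char_sum d (texp eta).
Proof.
apply/funext => n.
have /(_ n)/(congr1 (horner^~ x)) := twisted_bernoulliP chi eta K0 d_gt0.
rewrite /bernoulli_num /fps_mul !horner_sum => bern.
transitivity (\sum_(i < n.+1) (bernoulli_den d eta i *
   fps_egf (twisted_bernoulli d chi eta) (n - i)%N).[x]).
  rewrite psME; apply: eq_bigr => i _.
  rewrite hornerM bernoulli_denE hornerC /fps_egf hornerZ.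
  by rewrite psBE texpXE psCME ps1E.
rewrite bern psME; apply: eq_bigr => i _; rewrite hornerM !horner_sum; congr (_ * _).
  rewrite psME; apply: eq_bigr => j _; rewrite /fps_t /fps_exp hornerM hornerZ.
  by rewrite horner_exp hornerX -polyC_natr hornerC.
rewrite /char_sum ps_sumE; apply: eq_bigr => a _; rewrite !hornerZ horner_exp.
by rewrite -polyC_natr hornerC psCME texpXE psCME !mulrA.
Qed.

Lemma ps_scale_char_sum s m eta :
  ps_scale s%:R (char_sum m (texp (eta ^+ s))) =
  char_sum m (texp eta ^+ s).
Proof.
rewrite rmorph_sum; apply: eq_bigr => a _.
by rewrite rmorphM rmorphXn /= ps_scaleC ps_scale_texp.
Qed.

(** Substituting s t for t in [bernoulli_egfE] at [eta ^+ s] turns eta^s e^t into (eta e^t)^s. *)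
Lemma ps_scale_bernoulli_egf s eta x :
  (texp eta ^+ (s * d) - 1) * ps_scale s%:R (bernoulli_egf (eta ^+ s) x) =
  ps_const s%:R * ps_t K * ps_exp (s%:R * x) * char_sum d (texp eta ^+ s).
Proof.
rewrite -ps_scale_char_sum -ps_scale_exp -ps_scale_t -!rmorphM /=.
rewrite -bernoulli_egfE rmorphM rmorphB rmorphXn rmorph1 /=.
by rewrite ps_scale_texp exprM.
Qed.

Lemma char_sumE m eta k :
  char_sum m.+1 (texp eta) k = k`!%:R^-1 * twisted_power_sum chi eta k m.
Proof.
rewrite /char_sum ps_sumE mulr_sumr; apply: eq_bigr => a _.
by rewrite psCME texpXE psCME /ps_exp; ring.
Qed.

Hypothesis chi_periodic : forall a, chi (a + d%:Z) = chi a.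

Lemma char_sumM m z :
  (z ^+ d - 1) * char_sum (d * m) z = (z ^+ (d * m) - 1) * char_sum d z.
Proof.
by apply: (@geometric_periodic _ (fun a : nat => ps_const (chi a%:Z))) => i;
  rewrite PoszD chi_periodic.
Qed.

(** * The generating function of the six expressions and its symmetry *)

Variables (xi y : K).

(** The six expressions are the values of this one at the permutations of (w1, w2, w3). *)
Definition sym_expr (n u v w : nat) : K :=
  u%:R ^ (n%:Z - 1) *
  \sum_(k < n.+1) 'C(n, k)%:R *
    \sum_(a < (d * u)%N)
      chi (a : nat)%:Z * xi ^+ (a * v * w)%N *
      (twisted_bernoulli d chi (xi ^+ (u * w)%N) k).[v%:R * y + v%:R / u%:R * a%:R] *
      twisted_power_sum chi (xi ^+ (u * v)%N) (n - k)%N (d * w).-1 *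
      v%:R ^+ (n - k)%N * w%:R ^ ((k : nat)%:Z - 1).

Definition sym_egf (u v w : nat) : pseries K :=
  fun n => n`!%:R^-1 * sym_expr n u v w.

(** Since u^(n-1) v^(n-k) w^(k-1) = (u w)^k (u v)^(n-k) / (u w), the binomial sum is a Cauchy
    product of two series scaled by u w and u v; the factor u w on the left clears the
    denominator. *)
Lemma sym_egfE u v w : (0 < u)%N -> (0 < w)%N ->
  ps_const (u * w)%:R * sym_egf u v w =
  (\sum_(a < d * u) ps_const (chi (a : nat)%:Z * xi ^+ (a * v * w)) *
     ps_scale (u * w)%:R (bernoulli_egf (xi ^+ (u * w))
       (v%:R * y + v%:R / u%:R * a%:R))) *
  ps_scale (u * v)%:R (char_sum (d * w) (texp (xi ^+ (u * v)))).
Proof.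
move=> u0 w0; apply/funext => n; rewrite psCME psME.
have dw0 : (0 < d * w)%N by rewrite muln_gt0 d_gt0.
rewrite /sym_egf /sym_expr !mulr_sumr; apply: eq_bigr => k _.
rewrite ps_sumE !mulr_sumr mulr_suml; apply: eq_bigr => a _.
(* [twisted_power_sum] includes its upper bound, so the bound d w - 1 gives d w terms. *)
rewrite psCME /ps_scale /bernoulli_egf -[in RHS](prednK dw0) char_sumE.
have lekn : (k <= n)%N by rewrite -ltnS.
(* The exponents n - 1 and k - 1 can be -1, hence the division by the bases, which are nonzero in
   K. *)
have un : u%:R ^ (n%:Z - 1) = u%:R ^+ k * u%:R ^+ (n - k) / u%:R :> K.
  by rewrite -exprD subnKC // expfzDr ?natr_neq0.
have wk : w%:R ^ ((k : nat)%:Z - 1) = w%:R ^+ k / w%:R :> K.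
  by rewrite expfzDr ?natr_neq0.
rewrite un wk -(bin_fact lekn) !natrM !exprMn.
have := natr_neq0 u0; have := natr_neq0 w0.
have := factr_neq0 k; have := factr_neq0 (n - k).
have : 'C(n, k)%:R != 0 :> K by rewrite natr_neq0 ?bin_gt0.
move: (_ .[_]) (twisted_power_sum _ _ _ _) => b s c0 f0 g0 w0' u0'.
by field; rewrite c0 f0 g0 w0' u0'.
Qed.

(* The right-hand side is symmetric in u, v and w. *)
Lemma sym_egf_symmetric u v w : (0 < u)%N -> (0 < w)%N ->
  let X := texp xi in
  (X ^+ (u * w * d) - 1) * (X ^+ (v * w * d) - 1) * (X ^+ (u * v * d) - 1) *
    sym_egf u v w =
  ps_t K * ps_exp ((u * v * w)%:R * y) *
  char_sum d (X ^+ (u * w)) * char_sum d (X ^+ (v * w)) *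
  char_sum d (X ^+ (u * v)) * (X ^+ (u * v * w * d) - 1) ^+ 2.
Proof.
move=> u0 w0 X.
have uw0 : (u * w)%:R != 0 :> K by rewrite natr_neq0 // muln_gt0 u0.
(* The factor u w is introduced so that [sym_egfE] applies. *)
apply: (@ps_mulfI (ps_const (u * w)%:R) 0) => //.
(* Scaling by u w turns the argument into u v w y + v w a. The second summand contributes e^(v w a
   t), which joins xi^(a v w) to form X^(v w a), so that summing over a gives a character sum in
   X^(v w). *)
have bern (a : nat) : (X ^+ (u * w * d) - 1) *
    (ps_const (chi a%:Z * xi ^+ (a * v * w)) *
     ps_scale (u * w)%:R (bernoulli_egf (xi ^+ (u * w))
       (v%:R * y + v%:R / u%:R * a%:R))) =
    ps_const (u * w)%:R * ps_t K * ps_exp ((u * v * w)%:R * y) *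
    char_sum d (X ^+ (u * w)) *
    (ps_const (chi a%:Z) * (X ^+ (v * w)) ^+ a).
  rewrite (rmorphM (@ps_const K)) -mulrA mulrCA [X in _ * X]mulrCA.
  rewrite ps_scale_bernoulli_egf.
  have -> : (u * w)%:R * (v%:R * y + v%:R / u%:R * a%:R) =
      (u * v * w)%:R * y + (v * w * a)%:R :> K.
    by rewrite !natrM; field; exact: natr_neq0.
  rewrite ps_expD -exprM (texpXE _ (v * w * a)).
  have -> : (a * v * w = v * w * a)%N by ring.
  by ring.
transitivity
  ((X ^+ (v * w * d) - 1) * (X ^+ (u * v * d) - 1) *
   ((X ^+ (u * w * d) - 1) * (ps_const (u * w)%:R * sym_egf u v w))).
  by ring.
rewrite sym_egfE // ps_scale_char_sum.
rewrite [X in _ * X]mulrA [X in _ * (X * _)]mulr_sumr.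
under eq_bigr do rewrite bern.
rewrite -mulr_sumr -/(char_sum (d * u) (X ^+ (v * w))).
have := char_sumM u (X ^+ (v * w)); have := char_sumM w (X ^+ (u * v)).
rewrite -!exprM.
(* Both extended character sums produce the same numerator X^(u v w d) - 1, whence the square. *)
have -> : (u * v * (d * w) = u * v * w * d)%N by ring.
have -> : (v * w * (d * u) = u * v * w * d)%N by ring.
rewrite -/X => Ew Eu.
transitivity (ps_const (u * w)%:R * ps_t K * ps_exp ((u * v * w)%:R * y) *
  char_sum d (X ^+ (u * w)) *
  ((X ^+ (v * w * d) - 1) * char_sum (d * u) (X ^+ (v * w))) *
  ((X ^+ (u * v * d) - 1) * char_sum (d * w) (X ^+ (u * v)))).
  by ring.
by rewrite Ew Eu; ring.
Qed.

(** Exchanging v and w only permutes the factors on both sides of [sym_egf_symmetric]; the three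
    factors X^m - 1 on its left are then cancelled. *)
Lemma sym_expr_swap23 n u v w : (0 < u)%N -> (0 < v)%N -> (0 < w)%N ->
  sym_expr n u v w = sym_expr n u w v.
Proof.
move=> u0 v0 w0; suff /(congr1 (fun f : pseries K => f n)) :
  sym_egf u v w = sym_egf u w v by apply: mulfI; rewrite invr_eq0.
have := sym_egf_symmetric v u0 w0; have := sym_egf_symmetric w u0 v0.
rewrite (mulnC w v) (mulnAC u w v) => /= symE' symE.
apply: (@texpX_sub1_mulfI xi (u * v * d)); first by rewrite !muln_gt0 u0 v0.
apply: (@texpX_sub1_mulfI xi (v * w * d)); first by rewrite !muln_gt0 v0 w0.
apply: (@texpX_sub1_mulfI xi (u * w * d)); first by rewrite !muln_gt0 u0 w0.
rewrite !mulrA symE.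
transitivity ((texp xi ^+ (u * v * d) - 1) * (texp xi ^+ (v * w * d) - 1) *
  (texp xi ^+ (u * w * d) - 1) * sym_egf u w v); last by ring.
by rewrite symE'; ring.
Qed.

Lemma sym_expr_swap12 n u v w : (0 < u)%N -> (0 < v)%N -> (0 < w)%N ->
  sym_expr n u v w = sym_expr n v u w.
Proof.
move=> u0 v0 w0; suff /(congr1 (fun f : pseries K => f n)) :
  sym_egf u v w = sym_egf v u w by apply: mulfI; rewrite invr_eq0.
have := sym_egf_symmetric v u0 w0; have := sym_egf_symmetric u v0 w0.
rewrite (mulnC v u) => /= symE' symE.
apply: (@texpX_sub1_mulfI xi (u * v * d)); first by rewrite !muln_gt0 u0 v0.
apply: (@texpX_sub1_mulfI xi (v * w * d)); first by rewrite !muln_gt0 v0 w0.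
apply: (@texpX_sub1_mulfI xi (u * w * d)); first by rewrite !muln_gt0 u0 w0.
rewrite !mulrA symE.
transitivity ((texp xi ^+ (v * w * d) - 1) * (texp xi ^+ (u * w * d) - 1) *
  (texp xi ^+ (u * v * d) - 1) * sym_egf v u w); last by ring.
by rewrite symE'; ring.
Qed.

End Bernoulli.
End Exponential.

Theorem theorem4p5 (R : realType) (p : nat) (p_prime : prime p)
    (T : padic_tower R p) (xi : Cp T) (xi_ramified : ramified_root p xi)
    (d : nat) (d_gt0 : (0 < d)%N)
    (iota : {rmorphism algC -> Cp T})
    (chi0 : int -> algC) (chi0_primitive : primitive_dirichlet_char d chi0)
    (w1 w2 w3 : nat) (w1_gt0 : (0 < w1)%N) (w2_gt0 : (0 < w2)%N)
    (w3_gt0 : (0 < w3)%N)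
    (n : nat) (y1 : Qp T) (y1_int : padic_integer y1) :
  let chi : int -> Cp T := fun a => iota (chi0 a) in
  let B (k : nat) (eta x : Cp T) : Cp T :=
    (twisted_bernoulli d chi eta k).[x] in
  let PS (k m : nat) (eta : Cp T) : Cp T := twisted_power_sum chi eta k m in
  let y : Cp T := Qp_to_Cp y1 in
  let E (u v w : nat) : Cp T :=
    u%:R ^ (n%:Z - 1) *
    \sum_(k < n.+1) 'C(n, k)%:R *
      \sum_(a < (d * u)%N)
        chi (a : nat)%:Z * xi ^+ (a * v * w)%N *
        B k (xi ^+ (u * w)%N) (v%:R * y + v%:R / u%:R * a%:R) *
        PS (n - k)%N (d * w).-1 (xi ^+ (u * v)%N) *
        v%:R ^+ (n - k)%N * w%:R ^ ((k : nat)%:Z - 1) in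
  [/\ E w1 w2 w3 = E w1 w3 w2,
      E w1 w3 w2 = E w2 w1 w3,
      E w2 w1 w3 = E w2 w3 w1,
      E w2 w3 w1 = E w3 w1 w2
    & E w3 w1 w2 = E w3 w2 w1].
Proof.
move=> chi B PS y E.
have chi_periodic a : chi (a + d%:Z) = chi a.
  by rewrite /chi; case: chi0_primitive => -[_ _ -> _] _.
have swap23 u v w : (0 < u)%N -> (0 < v)%N -> (0 < w)%N -> E u v w = E u w v.
  exact: (sym_expr_swap23 (Cp_pchar0 T) d_gt0 chi_periodic).
have swap12 u v w : (0 < u)%N -> (0 < v)%N -> (0 < w)%N -> E u v w = E v u w.
  exact: (sym_expr_swap12 (Cp_pchar0 T) d_gt0 chi_periodic).
(* The three equalities that fix the first argument are single transpositions; each of the other two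
   composes both kinds. *)
split; [exact: swap23 | | exact: swap23 | | exact: swap23].
  by rewrite swap23 // swap12.
by rewrite swap12 // swap23.
Qed.
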